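(* Let $(X,d)$ be a compact metric space, let $m,n\in\mathbb N$, let $G$ be a subgroup of the symmetric group $S_m$, and let $g_i\colon SP^m_GX\to X$, $i=1,\dots,n$, be $SP^m_G$-generalized Matkowski contractions. Let $\ast$ be a triangular norm and let $\bigvee_{i=1}^n\alpha_i\ast\delta_i\in M^\ast(\{1,\dots,n\})$ (that is, $\alpha_1,\dots,\alpha_n\in[0,1]$ with $\max_i\alpha_i=1$). Then there exists a unique invariant $\ast$-measure for the $SP^m_G$-GIFS formed by the maps $g_1,\dots,g_n$ and the $\ast$-measure $\bigvee_{i=1}^n\alpha_i\ast\delta_i$; that is, there is a unique $\mu\in M^\ast(X)$ such that $$\mu=\bigvee_{i=1}^n\alpha_i\ast M^\ast(g_i)\big([\mu\otimes\dots\otimes\mu]_G\big),$$ where $\mu\otimes\dots\otimes\mu$ has $m$ factors.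
   Context: Spaces are nonempty. Let $\mathbb I=[0,1]$, and let $\vee$ denote maximum (applied pointwise to functions and functionals). Triangular norm: a continuous, associative, commutative, monotonic (nondecreasing in each argument) binary operation $\ast$ on $\mathbb I$ for which $1$ is a unit. $\ast$-measures: for a compact Hausdorff space $Y$, $C(Y,\mathbb I)$ is the set of continuous functions $Y\to\mathbb I$, and $c_Y$ is the constant function with value $c$. A $\ast$-measure on $Y$ is a functional $\mu\colon C(Y,\mathbb I)\to\mathbb I$ such that $\mu(c_Y)=c$, $\mu(\lambda\ast\varphi)=\lambda\ast\mu(\varphi)$ and $\mu(\varphi\vee\psi)=\mu(\varphi)\vee\mu(\psi)$ for all $c,\lambda\in\mathbb I$ and $\varphi,\psi\in C(Y,\mathbb I)$, where $(\lambda\ast\varphi)(y)=\lambda\ast\varphi(y)$. $M^\ast(Y)$ is the set of all $\ast$-measures on $Y$, with the weak* topology (basic neighbourhoods of $\mu$ are $\{\nu : |\mu(\varphi_i)-\nu(\varphi_i)|<\varepsilon,\ i=1,\dots,k\}$). For continuous $f\colon Y\to Z$, $M^\ast(f)\colon M^\ast(Y)\to M^\ast(Z)$ is given by $M^\ast(f)(\mu)(\varphi)=\mu(\varphi\circ f)$. $\delta_y$ is the Dirac functional $\delta_y(\varphi)=\varphi(y)$. For $\alpha\in\mathbb I$ and a functional $\nu$, $(\alpha\ast\nu)(\varphi)=\alpha\ast\nu(\varphi)$. The finite set $\{1,\dots,n\}$ carries the discrete topology. Tensor product: for $\mu\in M^\ast(Y)$, $\nu\in M^\ast(Z)$, let $f_y\colon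 Z\to Y\times Z$, $f_y(z)=(y,z)$, and $g\colon Y\to M^\ast(Y\times Z)$, $g(y)=M^\ast(f_y)(\nu)$. Then $\mu\otimes\nu=\zeta^\ast_{Y\times Z}(M^\ast(g)(\mu))\in M^\ast(Y\times Z)$, where $\zeta^\ast_W\colon M^\ast(M^\ast(W))\to M^\ast(W)$ is $\zeta^\ast_W(\mathcal M)(\varphi)=\mathcal M(\bar\varphi)$ with $\bar\varphi(\lambda)=\lambda(\varphi)$. Explicitly, $(\mu\otimes\nu)(\varphi)=\mu\big(y\mapsto\nu(z\mapsto\varphi(y,z))\big)$. Inductively, $\mu_1\otimes\dots\otimes\mu_m=((\mu_1\otimes\mu_2)\otimes\mu_3)\otimes\dots$. $G$-symmetric powers: $S_m$ is the group of bijections of $\{1,\dots,m\}$; a subgroup $G\le S_m$ acts on $X^m$ by permuting coordinates, and $SP^m_GX$ is the orbit space. The orbit of $(x_1,\dots,x_m)$ is $[x_1,\dots,x_m]_G$, and $\pi_G\colon X^m\to SP^m_GX$ is the quotient map. $SP^m_GX$ has the metric $$\hat d([x_1,\dots,x_m]_G,[y_1,\dots,y_m]_G)=\min_{\sigma\in G}\max_{1\le i\le m}d(x_i,y_{\sigma(i)}).$$ For $\mu\in M^\ast(X)$, $[\mu\otimes\dots\otimes\mu]_G=M^\ast(\pi_G)(\mu\otimes\dots\otimes\mu)\in M^\ast(SP^m_GX)$ ($m$ factors). Contractions: a map $f\colon SP^m_GX\to X$ is an $SP^m_G$-generalized Matkowski contraction if for some nondecreasing $\varphi\colon[0,\infty)\to[0,\infty)$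 with $\varphi^{(k)}(t)\to0$ as $k\to\infty$ for every $t>0$ ($\varphi^{(k)}$ being the $k$-th iterate), one has $d(f(x),f(y))\le\varphi(\hat d(x,y))$ for all $x,y\in SP^m_GX$. $SP^m_G$-GIFS: a collection of maps $g_i\colon SP^m_GX\to X$, $i=1,\dots,n$, together with a $\ast$-measure $\bigvee_{i=1}^n\alpha_i\ast\delta_i\in M^\ast(\{1,\dots,n\})$. Put $\Psi\colon M^\ast(SP^m_GX)\to M^\ast(X)$, $\Psi(\nu)=\bigvee_{i=1}^n\alpha_i\ast M^\ast(g_i)(\nu)$. An element $\mu\in M^\ast(X)$ is called invariant if $\mu=\Psi([\mu\otimes\dots\otimes\mu]_G)$. *)

(* Defs.v *)
From HB Require Import structures.
From mathcomp Require Import all_boot all_order all_algebra all_fingroup.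
From mathcomp Require Import generic_quotient interval_inference.
From mathcomp Require Import all_classical all_reals topology normedtype.
From mathcomp Require Import lra.

Set Implicit Arguments.
Unset Strict Implicit.
Unset Printing Implicit Defensive.

Import Order.TTheory GRing.Theory Num.Theory.
Import numFieldNormedType.Exports.

Local Open Scope classical_set_scope.
Local Open Scope ring_scope.

(* {i01 R} is already totally ordered in the library; here it receives the
   topology and the distance it inherits from R. *)
HB.instance Definition _ (R : realType) := PseudoMetric.copy {i01 R}
  (initial_topology (fun t : {i01 R} => t%:num)).

Section unit_interval.
Context {R : realType}.
Local Notation I := {i01 R}.

Lemma i01_val_continuous : continuous (fun t : I => t%:num).
Proof. exact: (@initial_continuous I R (fun t : I => t%:num)). Qed.

Lemma i01_continuousP (Y : topologicalType) (f : Y -> I) :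
  continuous f <-> continuous (fun y => (f y)%:num : R).
Proof.
split=> cf; last exact: (@continuous_comp_initial I Y R (fun t : I => t%:num)).
by move=> y; apply: continuous_comp; [exact: cf | exact: i01_val_continuous].
Qed.

Lemma i01_ballE (x y : I) (e : R) : ball x e y = (`|x%:num - y%:num| < e).
Proof. by []. Qed.

Lemma i01_le (x y : I) : (x <= y) = (x%:num <= y%:num :> R).
Proof. by []. Qed.

Lemma i01_ge0 (x : I) : 0 <= x%:num :> R. Proof. by []. Qed.
Lemma i01_le1 (x : I) : x%:num <= 1 :> R. Proof. by []. Qed.

Lemma i01_bot (x : I) : 0%:i01 <= x. Proof. by rewrite i01_le /=. Qed.
Lemma i01_top (x : I) : x <= 1%:i01. Proof. by rewrite i01_le /=. Qed.

Fact i01_clip_ge0 (x : R) : 0 <= Num.min (Num.max x 0) 1.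
Proof. by rewrite le_min le_max lexx orbT ler01. Qed.

Fact i01_clip_le1 (x : R) : Num.min (Num.max x 0) 1 <= 1.
Proof. by rewrite ge_min lexx orbT. Qed.

Definition i01_clip (x : R) : I := Itv01 (i01_clip_ge0 x) (i01_clip_le1 x).

Lemma i01_clip_continuous : continuous i01_clip.
Proof.
apply/i01_continuousP => x.
have h : {for x, continuous (fun z : R => Num.max z 0 : R^o)}.
  by apply: continuous_max; [exact: cvg_id|exact: cvg_cst].
have h1 : {for x, continuous (fun=> 1 : R^o)} by exact: cvg_cst.
exact: (continuous_min h h1).
Qed.

Lemma i01_clipK (x : I) : i01_clip x%:num = x.
Proof. by apply: val_inj => /=; rewrite max_l// min_l. Qed.

Lemma i01_clip_id (x : R) : 0 <= x -> x <= 1 -> (i01_clip x)%:num = x.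
Proof. by move=> x0 x1 /=; rewrite max_l// min_l. Qed.

Lemma i01_clip_le (x : R) : 0 <= x -> (i01_clip x)%:num <= x.
Proof. by move=> x0 /=; rewrite max_l// ge_min lexx. Qed.

Lemma i01_clip_ge (x t : R) : t <= x -> t <= 1 -> t <= (i01_clip x)%:num.
Proof. by move=> tx t1 /=; rewrite le_min le_max tx t1. Qed.

Lemma i01_clip_lip (x y : R) :
  `|(i01_clip x)%:num - (i01_clip y)%:num| <= `|x - y|.
Proof.
wlog xy : x y / y <= x.
  move=> h; have [/h//|/ltW/h] := leP y x.
  by rewrite distrC [leRHS]distrC.
rewrite [leRHS]ger0_norm ?subr_ge0// /=.
have [x0|x0] := leP x 0; have [y0|y0] := leP y 0.
- by rewrite subrr normr0 subr_ge0.
- by move: (lt_le_trans y0 xy); rewrite ltNge x0.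
- have [x1|x1] := leP x 1; have [y1|y1] := leP 0 1 => //; rewrite ler_norml; lra.
- have [x1|x1] := leP x 1; have [y1|y1] := leP y 1; rewrite ler_norml; lra.
Qed.

Lemma i01_compact : compact [set: I].
Proof.
have -> : [set: I] = i01_clip @` `[0, 1].
  apply/seteqP; split=> // x _; exists x%:num; last exact: i01_clipK.
  by rewrite /= in_itv /= i01_ge0 i01_le1.
apply: continuous_compact; last exact: segment_compact.
exact/continuous_subspaceT/i01_clip_continuous.
Qed.

End unit_interval.

Record tnorm (R : realType) := Tnorm {
  tnorm_op :> {i01 R} -> {i01 R} -> {i01 R};
  tnorm_continuous : continuous (fun p : {i01 R} * {i01 R} => tnorm_op p.1 p.2);
  tnormA : associative tnorm_op;
  tnormC : commutative tnorm_op;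
  tnorm_le : forall a a' b b', a <= a' -> b <= b' ->
    tnorm_op a b <= tnorm_op a' b';
  tnorm1 : right_id 1%:i01 tnorm_op }.

Section tnorm_theory.
Context {R : realType} (T : tnorm R).
Local Notation I := {i01 R}.

Lemma tnorm1l (a : I) : T 1%:i01 a = a.
Proof. by rewrite tnormC tnorm1. Qed.

Lemma tnormr0 (a : I) : T a 0%:i01 = 0%:i01.
Proof.
apply/eqP; rewrite eq_le; apply/andP; split; last exact: i01_bot.
by rewrite -[leRHS]tnorm1l; apply: tnorm_le => //; exact: i01_top.
Qed.

Lemma tnorm_le_l (a b : I) : T a b <= a.
Proof.
by rewrite -[leRHS](tnorm1 T); apply: tnorm_le => //; exact: i01_top.
Qed.

Lemma tnorm_max (a b c : I) : T a (Num.max b c) = Num.max (T a b) (T a c).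
Proof.
case: (leP b c) => bc; apply/esym.
  by apply: max_r; exact: tnorm_le.
by apply: max_l; apply: tnorm_le => //; exact: ltW.
Qed.

Lemma tnorm_unif (e : R) : 0 < e -> exists2 d : R, 0 < d &
  forall s s' k : I, `|s%:num - s'%:num| < d ->
    (T s k)%:num <= (T s' k)%:num + e.
Proof.
move=> e0.
have H : \forall d \near 0^'+, [set: I * I] `<=` (fun p : I * I =>
    forall s', `|p.1%:num - s'%:num| < d -> (T p.1 p.2)%:num <= (T s' p.2)%:num + e).
  have /compact_near_coveringP : compact [set: I * I].
    by rewrite -setXTT; apply: compact_setX; exact: i01_compact.
  apply=> -[s k] _.
  have /cvg_ballP/(_ (e / 2)) := @tnorm_continuous R T (s, k).
  rewrite divr_gt0// => /(_ isT) [[A B]] /= [+ Bk].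
  move=> /nbhs_ballP[r /= r0 rA] AB.
  have {}AB a b : `|s%:num - a%:num| < r -> B b ->
      `|(T s k)%:num - (T a b)%:num| < e / 2.
    by move=> sa Bb; apply: (AB (a, b)); split=> //; exact: rA.
  exists (ball s (r / 2) `*` B, [set d | d < r / 2]) => /=.
    split=> /=; last by apply: nbhs_right_lt; rewrite divr_gt0.
    exists (ball s (r / 2), B) => //=; split=> //.
    by apply: nbhsx_ballx; rewrite divr_gt0.
  move=> [[s1 k1] d] /= [[s1s k1B] dr] s2 s12.
  have {}s1s : `|s%:num - s1%:num| < r / 2 by [].
  have h1 := AB s1 k1 _ k1B; have h2 := AB s2 k1 _ k1B.
  have {}h1 := h1 ltac:(lra).
  have s2s : `|s%:num - s2%:num| < r.
    have := ler_distD s1%:num s%:num s2%:num; lra.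
  have {}h2 := h2 s2s.
  move: h1 h2; rewrite !ltr_distl => /andP[h1 h1'] /andP[h2 h2']; lra.
near (0 : R)^'+ => d; exists d; first by near: d; exact: nbhs_right_gt.
have Hd : [set: I * I] `<=` (fun p : I * I =>
    forall s', `|p.1%:num - s'%:num| < d ->
      (T p.1 p.2)%:num <= (T s' p.2)%:num + e) by near: d.
by move=> s s' k; exact: (Hd (s, k)).
Unshelve. all: by end_near. Qed.
End tnorm_theory.

Lemma ptws_continuousP (Y : topologicalType) (K : eqType) (Z : topologicalType)
    (f : Y -> {ptws K -> Z}) :
  continuous f <-> forall k, continuous (fun y => f y k).
Proof.
split=> [cf k y|cf y].
  apply: (@continuous_comp _ _ _ f (fun g : {ptws K -> Z} => g k)).
    exact: cf.
  exact: (@proj_continuous K (fun=> Z) k).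
apply/cvg_sup => k U [_ [[W oW <-]]] Wf /filterS; apply.
by apply: (cf k y); exact: open_nbhs_nbhs.
Qed.

Section star_measures.
Context {R : realType} (T : tnorm R).
Local Notation I := {i01 R}.
Local Notation C Y := (continuousType Y I).

Section cfun_operations.
Context {Y : topologicalType}.
Implicit Types (l : I) (phi psi : C Y).

Fact cstar_continuous l phi : continuous (fun y => T l (phi y)).
Proof.
move=> y; have hl : (fun=> l) @ y --> l by exact: cvg_cst.
have := continuous2_cvg _ (@tnorm_continuous R T (l, phi y)) hl (@cts_fun _ _ phi y).
exact.
Qed.

Definition cstar l phi : C Y := mkcts (@cstar_continuous l phi).

Fact cmax_continuous phi psi : continuous (fun y => Num.max (phi y) (psi y)).
Proof.
apply/i01_continuousP => y.
have h (f : C Y) : continuous (fun z => (f z)%:num : R).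
  by apply/i01_continuousP; exact: cts_fun.
have -> : (fun z => (Num.max (phi z) (psi z))%:num) =
    (fun z => (phi z)%:num) \max (fun z => (psi z)%:num) :> (Y -> R).
  by apply/funext => z /=; rewrite num_max.
exact: (continuous_max (h phi y) (h psi y)).
Qed.

Definition cmax phi psi : C Y := mkcts (@cmax_continuous phi psi).

End cfun_operations.

Definition is_star_measure (Y : topologicalType) (mu : C Y -> I) : Prop :=
  [/\ forall c, mu (cst c) = c,
      forall l phi, mu (cstar l phi) = T l (mu phi) &
      forall phi psi, mu (cmax phi psi) = Num.max (mu phi) (mu psi)].

(* Defined over any topological space; the spaces of interest are compact and
   Hausdorff. *)
Record star_measure (Y : topologicalType) := StarMeasure {
  star_measure_fun :> C Y -> I;
  star_measureP : is_star_measure star_measure_fun }.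

HB.instance Definition _ (Y : topologicalType) :=
  gen_eqMixin (star_measure Y).
HB.instance Definition _ (Y : topologicalType) :=
  gen_choiceMixin (star_measure Y).
(* The weak* topology: the initial topology for the evaluations at all phi. *)
HB.instance Definition _ (Y : topologicalType) :=
  Topological.copy (star_measure Y)
    (initial_topology (@star_measure_fun Y : star_measure Y -> {ptws C Y -> I})).

Lemma star_measure_eqP (Y : topologicalType) (mu nu : star_measure Y) :
  mu = nu <-> forall phi, mu phi = nu phi.
Proof.
split=> [->//|]; case: mu nu => [mu mP] [nu nP] /= h.
have {}h : mu = nu by exact/funext.
by subst nu; congr StarMeasure; exact: Prop_irrelevance.
Qed.

Lemma star_measure_continuousP (Z Y : topologicalType)
    (f : Z -> star_measure Y) :
  continuous f <-> forall phi, continuous (fun z => f z phi).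
Proof.
split=> [cf|cf].
  apply/(ptws_continuousP (fun z => f z : {ptws C Y -> I})) => z.
  apply: (@continuous_comp _ _ _ f
    (@star_measure_fun Y : star_measure Y -> {ptws C Y -> I})); first exact: cf.
  exact: initial_continuous.
apply: continuous_comp_initial.
exact/(ptws_continuousP (fun z => f z : {ptws C Y -> I})).
Qed.

Section star_map.
Context {Y Z : topologicalType} (f : continuousType Y Z) (mu : star_measure Y).

Fact star_map_subproof : is_star_measure (fun phi : C Z => mu (phi \o f)).
Proof.
have [m1 m2 m3] := star_measureP mu; split=> [c|l phi|phi psi].
- by rewrite -[RHS]m1; congr (mu _); exact/continuousEP.
- by rewrite -m2; congr (mu _); exact/continuousEP.
- by rewrite -m3; congr (mu _); exact/continuousEP.
Qed.

Definition star_map : star_measure Z := StarMeasure star_map_subproof.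

End star_map.

Section star_mult.
Context {W : topologicalType}.

Fact star_eval_continuous (phi : C W) :
  continuous (fun lam : star_measure W => lam phi).
Proof. by move: phi; apply/star_measure_continuousP => x; exact: cvg_id. Qed.

Definition star_eval (phi : C W) : C (star_measure W) :=
  mkcts (@star_eval_continuous phi).

Fact star_mult_subproof (M : star_measure (star_measure W)) :
  is_star_measure (fun phi => M (star_eval phi)).
Proof.
have [m1 m2 m3] := star_measureP M; split=> [c|l phi|phi psi].
- rewrite -[RHS]m1; congr (M _); apply/continuousEP => lam /=.
  by have [+ _ _] := star_measureP lam; exact.
- rewrite -m2; congr (M _); apply/continuousEP => lam /=.
  by have [_ + _] := star_measureP lam; exact.
- rewrite -m3; congr (M _); apply/continuousEP => lam /=.
  by have [_ _ +] := star_measureP lam; exact.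
Qed.

Definition star_mult (M : star_measure (star_measure W)) : star_measure W :=
  StarMeasure (star_mult_subproof M).

End star_mult.

Lemma star_measure_le (Y : topologicalType) (mu : star_measure Y)
    (phi psi : C Y) : (forall y, phi y <= psi y) -> mu phi <= mu psi.
Proof.
move=> le_phi_psi; have [_ _ muU] := star_measureP mu.
suff <- : cmax phi psi = psi by rewrite muU le_max lexx.
by apply/continuousEP => y /=; apply: max_r.
Qed.

Lemma star_measure_unif (Y : topologicalType) (mu : star_measure Y) (e : R) :
  0 < e -> exists2 d : R, 0 < d & forall phi psi : C Y,
    (forall y, (phi y)%:num <= (psi y)%:num + d) ->
    (mu phi)%:num <= (mu psi)%:num + e.
Proof.
move=> e0; have [d0 d0_gt0 Td] := tnorm_unif T e0.
have [muc muT muU] := star_measureP mu.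
pose d := Num.min (d0 / 4) e.
have d_gt0 : 0 < d by rewrite lt_min e0 divr_gt0.
have d_le : d <= d0 / 4 by rewrite ge_min lexx.
have d_lee : d <= e by rewrite ge_min lexx orbT.
exists d => //.
have comp_cts (h : R -> R) (phi : C Y) : continuous h ->
    continuous (fun y => i01_clip (h (phi y)%:num)).
  move=> hc y; apply: (continuous_comp (f := fun y => h (phi y)%:num)).
    apply: (continuous_comp (f := fun y => (phi y)%:num)); last exact: hc.
    have /i01_continuousP := @cts_fun _ _ phi; exact.
  exact: i01_clip_continuous.
suff key (k : nat) : forall phi psi : C Y,
    (forall y, (phi y)%:num <= (psi y)%:num + d) ->
    (forall y, (phi y)%:num <= k.+1%:R * d) ->
    (mu phi)%:num <= (mu psi)%:num + e.
  move=> phi psi phipsi; apply: (key (Num.bound d^-1)) => // y.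
  have := archi_boundP (ltW (_ : 0 < d^-1)); rewrite invr_gt0 => /(_ d_gt0).
  rewrite -(ltr_pM2r d_gt0) mulVf ?gt_eqF// => h.
  by rewrite (le_trans (i01_le1 (phi y)))// (le_trans (ltW h))// ler_pM2r// ler_nat.
elim: k => [|k IH] phi psi phipsi phik.
  have : mu phi <= mu (cst (i01_clip d)).
    apply: star_measure_le => y; rewrite i01_le /= le_min i01_le1 andbT le_max.
    by rewrite -[d]mul1r phik.
  rewrite muc i01_le => h; apply: (le_trans h).
  apply: (le_trans (i01_clip_le (ltW d_gt0))).
  by rewrite (le_trans d_lee)// lerDr.
pose a : R := k%:R * d.
have a_ge0 : 0 <= a by rewrite mulr_ge0// ltW.
have aS : k.+1%:R * d = a + d by rewrite -natr1 mulrDl mul1r.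
have aSS : k.+2%:R * d = a + d + d by rewrite -natr1 mulrDl mul1r aS.
rewrite aSS in phik; rewrite aS in IH.
have h1 : continuous (fun r : R => Num.min r (a + d)).
  by move=> r; apply: (@continuous_min _ _ (id : R -> R^o) (fun=> a + d));
    [exact: cvg_id|exact: cvg_cst].
have h2 : continuous (fun r : R => (r - a) / d).
  move=> r; apply: (@cvgM R _ (nbhs r)); last exact: cvg_cst.
  by apply: (@cvgB R R^o _ (nbhs r)); [exact: cvg_id|exact: cvg_cst].
pose phi' : C Y := mkcts (@comp_cts _ phi h1).
pose chi : C Y := mkcts (@comp_cts _ phi h2).
have phi'E y : (phi' y)%:num = Num.min (phi y)%:num (a + d).
  apply: i01_clip_id; rewrite ?le_min ?ge_min ?i01_ge0 ?i01_le1//=.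
  by rewrite addr_ge0// ltW.
have le1 : mu phi <= Num.max (mu phi') (T (i01_clip (a + d + d)) (mu chi)).
  rewrite -muT -muU; apply: star_measure_le => y.
  rewrite [cmax _ _ y]/= le_max; have [phiy|phiy] := leP (phi y)%:num (a + d).
    by apply/orP; left; rewrite i01_le phi'E min_l.
  apply/orP; right; have chiy : chi y = 1%:i01.
    apply: val_inj => /=; rewrite min_r// le_max; apply/orP; left.
    by rewrite ler_pdivlMr// mul1r lerBrDl ltW.
  rewrite (_ : cstar _ _ y = i01_clip (a + d + d)).
    by rewrite i01_le; exact: i01_clip_ge.
  by rewrite -[RHS](tnorm1 T) -chiy.
have le2 : (mu phi')%:num <= (mu psi)%:num + e.
  apply: IH => y; rewrite phi'E.
    by rewrite (le_trans _ (phipsi y))// ge_min lexx.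
  by rewrite ge_min lexx orbT.
have le3 : (T (i01_clip (a + d + d)) (mu chi))%:num <= (mu psi)%:num + e.
  apply: (le_trans (Td _ (i01_clip (a - d)) (mu chi) _)).
    apply: le_lt_trans (i01_clip_lip _ _) _.
    have -> : a + d + d - (a - d) = 3 * d by lra.
    by rewrite gtr0_norm; lra.
  rewrite lerD2r -i01_le -muT; apply: star_measure_le => y.
  have [phiy|phiy] := leP (phi y)%:num a.
    have chiy : chi y = 0%:i01.
      apply: val_inj => /=; rewrite max_r ?min_l//.
      by rewrite pmulr_lle0 ?invr_gt0// subr_le0.
    rewrite (_ : cstar _ _ y = 0%:i01) ?i01_bot//.
    by rewrite -[RHS](tnormr0 T (i01_clip (a - d))) -chiy.
  apply: (le_trans (tnorm_le_l _ _ _)); rewrite i01_le /= ge_min; apply/orP; left.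
  by rewrite ge_max i01_ge0 andbT; have := phipsi y; lra.
move: le1; rewrite i01_le num_max => le1; apply: (le_trans le1).
by rewrite ge_max le2 le3.
Qed.

(* Compactness of the right-hand factor makes y |-> M(f_y)(nu) weak*
   continuous. *)
Section tensor.
Context {Y Z : topologicalType} (cZ : compact [set: Z]).

Fact pair_continuous (y : Y) : continuous (fun z : Z => (y, z)).
Proof. by move=> z; apply: cvg_pair => /=; [exact: cvg_cst|exact: cvg_id]. Qed.

Definition star_slice (nu : star_measure Z) (y : Y) : star_measure (Y * Z)%type :=
  star_map (mkcts (@pair_continuous y)) nu.

Fact star_slice_continuous (nu : star_measure Z) : continuous (star_slice nu).
Proof.
apply/star_measure_continuousP => phi y.
apply/cvg_ballP => e e0.
have e20 : 0 < e / 2 by rewrite divr_gt0.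
have [d d0 nud] := star_measure_unif nu e20.
have : \forall y' \near y, [set: Z] `<=`
    (fun z => `|(phi (y, z))%:num - (phi (y', z))%:num| < d).
  move/compact_near_coveringP: cZ; apply=> z _.
  have d20 : 0 < d / 2 by rewrite divr_gt0.
  have /cvg_ballP/(_ _ d20) [[A B] /= [Ay Bz] AB] := @cts_fun _ _ phi (y, z).
  exists (B, A) => //= -[z' y'] /= [Bz' Ay'].
  have h1 : `|(phi (y, z))%:num - (phi (y, z'))%:num| < d / 2.
    by apply: (AB (y, z')); split=> //=; exact: nbhs_singleton.
  have h2 : `|(phi (y, z))%:num - (phi (y', z'))%:num| < d / 2 by apply: (AB (y', z')).
  by move: h1 h2; rewrite !ltr_distl => /andP[? ?] /andP[? ?]; apply/andP; split; lra.
apply: filterS => y' phiy'; rewrite i01_ballE.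
have h z : `|(phi (y, z))%:num - (phi (y', z))%:num| < d by exact: phiy'.
have le1 : (star_slice nu y phi)%:num <= (star_slice nu y' phi)%:num + e / 2.
  by apply: nud => z /=; have := h z; rewrite ltr_distl => /andP[_ ?]; lra.
have le2 : (star_slice nu y' phi)%:num <= (star_slice nu y phi)%:num + e / 2.
  by apply: nud => z /=; have := h z; rewrite ltr_distl => /andP[? ?]; lra.
rewrite ltr_distl; apply/andP; split; lra.
Qed.

Definition star_tensor (mu : star_measure Y) (nu : star_measure Z) :
    star_measure (Y * Z)%type :=
  star_mult (star_map (mkcts (@star_slice_continuous nu)) mu).

Lemma star_tensorE (mu : star_measure Y) (nu : star_measure Z)
    (phi : C (Y * Z)%type) (phi_ : Y -> C Z) (psi : C Y) :
  (forall y z, phi_ y z = phi (y, z)) -> (forall y, psi y = nu (phi_ y)) ->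
  star_tensor mu nu phi = mu psi.
Proof.
move=> phi_E psiE; congr (mu _); apply/continuousEP => y /=.
by rewrite psiE; congr (nu _); apply/continuousEP => z /=; rewrite phi_E.
Qed.

End tensor.
End star_measures.

Section tensor_power.
Context {R : realType} (T : tnorm R) {X : topologicalType}.

Fact pow_one_continuous :
  continuous (fun x : X => (fun=> x) : {ptws 'I_1 -> X}).
Proof.
by apply/(ptws_continuousP (fun x : X => (fun=> x) : {ptws 'I_1 -> X})) => i x;
  exact: cvg_id.
Qed.

Definition pow_one : continuousType X {ptws 'I_1 -> X} :=
  mkcts pow_one_continuous.

Definition rcons_fun m (p : {ptws 'I_m -> X} * X) : {ptws 'I_m.+1 -> X} :=
  fun i => if unlift ord_max i is Some j then p.1 j else p.2.

Fact rcons_fun_continuous m : continuous (@rcons_fun m).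
Proof.
apply/ptws_continuousP => i p; rewrite /rcons_fun.
case: (unlift _ _) => [j|]; last exact: cvg_snd.
apply: (@continuous_comp _ _ _ fst (fun g : {ptws 'I_m -> X} => g j)).
  exact: cvg_fst.
exact: (@proj_continuous _ (fun=> X) j).
Qed.

Definition pow_rcons m :
    continuousType ({ptws 'I_m -> X} * X)%type {ptws 'I_m.+1 -> X} :=
  mkcts (@rcons_fun_continuous m).

(* star_tensor_pow cX mu m is the tensor product of m.+1 copies of mu, bracketed
   to the left and carried along the homeomorphisms X = X^1 (pow_one) and
   X^k x X = X^(k+1) (pow_rcons). *)
Fixpoint star_tensor_pow (cX : compact [set: X]) (mu : star_measure T X)
    (m : nat) : star_measure T {ptws 'I_m.+1 -> X} :=
  if m is m'.+1 then
    star_map (pow_rcons m'.+1) (star_tensor cX (star_tensor_pow cX mu m') mu)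
  else star_map pow_one mu.

End tensor_power.

Section symmetric_power.
Local Open Scope quotient_scope.
Context (X : topologicalType) (m : nat) (G : {group 'S_m}).
Local Notation Xm := {ptws 'I_m -> X}.

Definition orbit_rel (x y : Xm) : bool :=
  `[< exists2 s : 'S_m, s \in G & y = x \o s >].

Fact orbit_rel_refl : reflexive orbit_rel.
Proof.
by move=> x; apply/asboolP; exists 1%g => //; apply/funext => i /=; rewrite perm1.
Qed.

Fact orbit_rel_sym : symmetric orbit_rel.
Proof.
suff h x y : orbit_rel x y -> orbit_rel y x by move=> x y; apply/idP/idP; exact: h.
move=> /asboolP[s sG ->]; apply/asboolP; exists s^-1%g; first by rewrite groupV.
by apply/funext => i /=; rewrite permKV.
Qed.

Fact orbit_rel_trans : transitive orbit_rel.
Proof.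
move=> y x z /asboolP[s sG ->] /asboolP[t tG ->]; apply/asboolP.
exists (t * s)%g; first by rewrite groupM.
by apply/funext => i /=; rewrite permM.
Qed.

Canonical orbit_equiv :=
  EquivRel orbit_rel orbit_rel_refl orbit_rel_sym orbit_rel_trans.

Definition sym_power := quotient_topology {eq_quot orbit_equiv}.

HB.instance Definition _ := Topological.on sym_power.
HB.instance Definition _ := Quotient.on sym_power.

Definition sym_pi : continuousType Xm sym_power :=
  mkcts (@pi_continuous _ {eq_quot orbit_equiv}).

Lemma sym_piP (x y : Xm) :
  sym_pi x = sym_pi y <-> exists2 s : 'S_m, s \in G & y = x \o s.
Proof.
split=> [/eqmodP/asboolP//|h].
by apply/eqmodP/asboolP.
Qed.

End symmetric_power.

Section symmetric_power_distance.
Context {R : realType} {X : metricType R} {m : nat} {G : {group 'S_m}}.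
Implicit Types (x y : {ptws 'I_m -> X}) (a b : sym_power X G) (s t u : 'S_m).

Definition perm_dist x y s : R := \big[Num.max/0]_(i < m) mdist (x i) (y (s i)).

(* The distance is computed on chosen representatives; sym_distE shows that it
   does not depend on them.  The default value of the minimum is the term at the
   identity, which belongs to G. *)
Definition sym_dist a b : R :=
  \big[Num.min/perm_dist (repr a) (repr b) 1%g]_(s in G)
    perm_dist (repr a) (repr b) s.

Lemma perm_dist_leP x y s (r : R) :
  reflect (0 <= r /\ forall i, mdist (x i) (y (s i)) <= r)
    (perm_dist x y s <= r).
Proof.
by apply: (iffP (bigmax_leP _ _ _ _)) => -[r0 h]; split=> // i *; exact: h.
Qed.

Lemma perm_dist_comp x y s t u :
  perm_dist (x \o s) (y \o t) u = perm_dist x y (s^-1 * u * t)%g.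
Proof.
apply/eqP; rewrite eq_le; apply/andP; split.
- have /perm_dist_leP[h0 h] := lexx (perm_dist x y (s^-1 * u * t)%g).
  apply/perm_dist_leP; split=> // i; have := h (s i).
  by rewrite !permM permK.
- have /perm_dist_leP[h0 h] := lexx (perm_dist (x \o s) (y \o t) u).
  apply/perm_dist_leP; split=> // i; have := h (s^-1%g i).
  by rewrite /= permKV !permM.
Qed.

Lemma sym_distE x y : sym_dist (sym_pi X G x) (sym_pi X G y) =
  \big[Num.min/perm_dist x y 1%g]_(s in G) perm_dist x y s.
Proof.
rewrite /sym_dist.
have /sym_piP[s sG xE] : sym_pi X G x = sym_pi X G (repr (sym_pi X G x)).
  by rewrite [RHS]reprK.
have /sym_piP[t tG yE] : sym_pi X G y = sym_pi X G (repr (sym_pi X G y)).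
  by rewrite [RHS]reprK.
have minP (x' y' : {ptws 'I_m -> X}) (r : R) :
    (r <= \big[Num.min/perm_dist x' y' 1%g]_(u in G) perm_dist x' y' u) <->
    forall u, u \in G -> r <= perm_dist x' y' u.
  split=> [/bigmin_geP[]//|h]; apply/bigmin_geP; split=> //; exact: h.
rewrite {}xE {}yE; apply/eqP; rewrite eq_le; apply/andP; split.
- apply/minP => u uG; have /minP/(_ (s * u * t^-1)%g) := lexx
    (\big[Num.min/perm_dist (x \o s) (y \o t) 1%g]_(v in G)
      perm_dist (x \o s) (y \o t) v).
  rewrite [perm_dist _ _ (_ * _)%g]perm_dist_comp !mulgA mulVg mul1g mulgKV.
  by apply; rewrite !groupM ?groupV.
- apply/minP => u uG; rewrite perm_dist_comp.
  have /minP := lexx (\big[Num.min/perm_dist x y 1%g]_(v in G) perm_dist x y v).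
  by apply; rewrite !groupM ?groupV.
Qed.

Lemma sym_dist_ge0 a b : 0 <= sym_dist a b.
Proof.
have h s : 0 <= perm_dist (repr a) (repr b) s by exact: bigmax_ge_id.
by apply/bigmin_geP.
Qed.

(* phi : [0, +oo[ -> [0, +oo[ is represented by a function on R of which only
   the values on the nonnegative reals matter. *)
Definition matkowski_contraction (f : sym_power X G -> X) : Prop :=
  exists phi : R -> R,
    [/\ forall t : R, 0 <= t -> 0 <= phi t,
        forall s t : R, 0 <= s -> s <= t -> phi s <= phi t,
        forall t : R, 0 < t -> (fun k => iter k phi t) @ \oo --> (0 : R) &
        forall a b, mdist (f a) (f b) <= phi (sym_dist a b)].

Lemma matkowski_continuous (f : sym_power X G -> X) :
  matkowski_contraction f -> continuous f.
Proof.
move=> [phi [phi0 phi_le phi_cvg f_phi]].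
have phi_lt (t : R) : 0 < t -> phi t < t.
  move=> t0; rewrite ltNge; apply/negP => t_phi.
  have h k : t <= iter k phi t.
    elim: k => //= k IH; apply: (le_trans t_phi); apply: phi_le => //.
    exact: ltW.
  have /cvgrPdist_lt/(_ _ t0)[N _ /(_ N (leqnn N))] := phi_cvg t t0.
  by rewrite /= sub0r normrN ger0_norm ?(le_trans (ltW t0))// ltNge h.
apply/quotient_continuous => x.
apply/(@cvg_ballP _ X _ _ (nbhs_filter (x : {ptws 'I_m -> X}))) => e e0.
have : \forall y \near x, forall i : 'I_m, mdist (x i) (y i) < e.
  apply: (@filter_forall _ _ _ (nbhs x) (nbhs_filter x)) => i.
  have := @proj_continuous 'I_m (fun=> X) i x.
  move/(@cvg_ballP _ X _ _ (nbhs_filter (x : {ptws 'I_m -> X})))/(_ _ e0).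
  by apply: filterS => y; rewrite ballEmdist.
apply: filterS => y xy; rewrite ballEmdist /=.
apply: (le_lt_trans (f_phi _ _)); apply: le_lt_trans (phi_lt _ e0).
apply: phi_le; first exact: sym_dist_ge0.
rewrite [leLHS](sym_distE x y).
apply: (le_trans (bigmin_le_id _ _ _ _)); apply/perm_dist_leP.
by split=> [|i]; rewrite ?perm1; exact: ltW.
Qed.

End symmetric_power_distance.

Section gifs.
Context {R : realType} (T : tnorm R).
Local Notation I := {i01 R}.
Local Notation C Y := (continuousType Y I).

Definition dirac_fun (Y : topologicalType) (y : Y) : C Y -> I :=
  fun phi => phi y.

Definition star_sup (Y : topologicalType) (n : nat) (alpha : 'I_n -> I)
    (nu : 'I_n -> C Y -> I) : C Y -> I :=
  fun phi => \big[Num.max/0%:i01]_(i < n) T (alpha i) (nu i phi).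

Definition finite_star_fun (n : nat) (alpha : 'I_n -> I) :
    C (discrete_topology 'I_n) -> I :=
  star_sup alpha (fun i => @dirac_fun (discrete_topology 'I_n) i).

Lemma star_sup_subproof (Y : topologicalType) (n : nat) (alpha : 'I_n -> I)
    (nu : 'I_n -> C Y -> I) :
  \big[Num.max/0%:i01]_(i < n) alpha i = 1%:i01 ->
  (forall i, is_star_measure T (nu i)) -> is_star_measure T (star_sup alpha nu).
Proof.
move=> alpha1 nuP.
have supZ (l : I) (F : 'I_n -> I) : \big[Num.max/0%:i01]_(i < n) T l (F i) =
    T l (\big[Num.max/0%:i01]_(i < n) F i).
  apply/esym; apply: (big_morph (T l)); last exact: tnormr0.
  by move=> a b; exact: tnorm_max.
split=> [c|l phi|phi psi].
- rewrite -[RHS](tnorm1 T) -alpha1 -supZ; apply: eq_bigr => i _.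
  by have [-> _ _] := nuP i; rewrite tnormC.
- rewrite -supZ; apply: eq_bigr => i _; have [_ -> _] := nuP i.
  by rewrite !tnormA (tnormC T (alpha i)).
- rewrite /star_sup; elim/big_rec3: _ => [|i a b c _ ->]; first by rewrite maxxx.
  by have [_ _ ->] := nuP i; rewrite tnorm_max maxACA.
Qed.

(* The functional with weights alpha is a measure on {0, ..., n - 1} exactly when
   the largest weight is 1; in particular n is then positive. *)
Lemma finite_star_measureP (n : nat) (alpha : 'I_n -> I) :
  is_star_measure T (finite_star_fun alpha) <->
  \big[Num.max/0%:i01]_(i < n) alpha i = 1%:i01.
Proof.
split=> [[h _ _]|h]; last exact: star_sup_subproof.
rewrite -[RHS]h; apply: eq_bigr => i _; by rewrite [RHS]tnorm1.
Qed.

Section gifs_operator.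
Context {Y Z : topologicalType} {n : nat} (alpha : 'I_n -> I)
  (alphaP : is_star_measure T (finite_star_fun alpha))
  (g : 'I_n -> continuousType Y Z).

Definition gifs_operator (nu : star_measure T Y) : star_measure T Z :=
  StarMeasure (star_sup_subproof ((finite_star_measureP alpha).1 alphaP)
    (fun i => star_measureP (star_map (g i) nu))).

Lemma gifs_operatorE (nu : star_measure T Y) (phi : C Z) :
  gifs_operator nu phi = star_sup alpha (fun i => star_map (g i) nu) phi.
Proof. by []. Qed.

End gifs_operator.
End gifs.

Definition sym_tensor_pow (R : realType) (T : tnorm R) (X : topologicalType)
    (cX : compact [set: X]) (m : nat) (G : {group 'S_m.+1})
    (mu : star_measure T X) : star_measure T (sym_power X G) :=
  star_map (sym_pi X G) (star_tensor_pow cX mu m).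

Definition gifs_invariant (R : realType) (T : tnorm R) (X : metricType R)
    (cX : compact [set: X]) (m n : nat) (G : {group 'S_m.+1})
    (g : 'I_n -> sym_power X G -> X)
    (gP : forall i, matkowski_contraction (g i)) (alpha : 'I_n -> {i01 R})
    (alphaP : is_star_measure T (finite_star_fun T alpha))
    (mu : star_measure T X) : Prop :=
  mu = gifs_operator alphaP (fun i => mkcts (matkowski_continuous (gP i)))
    (sym_tensor_pow cX G mu).

(* Main.v *)
Require Import Defs.
From HB Require Import structures.
From mathcomp Require Import all_boot all_order all_algebra all_fingroup.
From mathcomp Require Import interval_inference.
From mathcomp Require Import all_classical all_reals topology normedtype.
From mathcomp Require Import lra.

Import Order.TTheory GRing.Theory Num.Theory.
Import numFieldNormedType.Exports.

Local Open Scope classical_set_scope.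
Local Open Scope ring_scope.

(** The set of star-measures is compared through couplings instead of a metric.
For a relation E on a space Y, say that nu dominates mu along E when
mu phi <= nu psi for all continuous phi, psi such that phi x <= psi y whenever
E x y.  When E is [d x y <= r] this plays the part of a one-sided Hausdorff
distance at most r between mu and nu, but it asks nothing of the triangular
norm: domination passes to images under maps, to tensor products (because the
tensor product is an iterated application of monotone functionals), to weighted
maxima, and to pointwise limits.

Write Phi for the operator whose fixed points are the invariant measures, and
phi_i for the comparison function of g_i.  The permanence properties show that
domination at scale r between mu and nu becomes domination at scale t between
Phi mu and Phi nu as soon as phi_i r <= t for all i
([star_dominated_gifs_step]).  Any two measures dominate each other at the scale
of the diameter of X.  Let S be the set of scales r at which Phi^k mu and
Phi^k nu dominate each other for all mu, nu and all large k.  A comparison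
function satisfies phi r < r, and phi s <= r for some s > r; applied to r = inf S
these two facts force inf S = 0 ([comparison_family_inf]).  In this way different
comparison functions are treated together, and no bound on the speed of
convergence is needed.

Two measures that dominate each other at all positive scales are equal
([star_dominated_antisym]): phi is uniformly continuous, hence
mu phi <= nu (phi + s) at a small scale, and nu is uniformly continuous.  This
gives uniqueness.  For existence, the iterates of Phi at a Dirac measure have a
pointwise limit mu along an ultrafilter ([star_measure_ultralimit]).  At each
positive scale the late iterates and mu dominate each other; applying Phi keeps
the scale, so that the late iterates and Phi mu also dominate each other, and
passing to the limit once more gives domination between mu and Phi mu. *)

(** * Comparison functions *)

Section comparison_functions.
Set Implicit Arguments.
Unset Strict Implicit.
Context {R : realType}.
Implicit Types (phi : R -> R) (r s t : R).

(** Iterates that tend to 0 leave every invariant property that keeps its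
arguments above a fixed positive level.  The two ways in which a comparison
function decreases follow by taking for P the closed and the open half-line
starting at r. *)
Lemma iter_vanishing_escape phi (P : R -> Prop) r t :
  0 < r -> (forall s, P s -> r <= s) -> (forall s, P s -> P (phi s)) -> P t ->
  ~ (fun k => iter k phi t) @ \oo --> (0 : R).
Proof.
move=> r0 rP phiP Pt /cvgrPdist_lt/(_ _ r0)[N _ /(_ N (leqnn N))] /=.
have : P (iter N phi t) by elim: N => //= k; exact: phiP.
by move=> /rP rN; rewrite sub0r normrN ger0_norm ?ltNge ?rN// (le_trans (ltW r0)).
Qed.

Lemma comparison_lt phi r :
  (forall s t, 0 <= s -> s <= t -> phi s <= phi t) ->
  (forall t, 0 < t -> (fun k => iter k phi t) @ \oo --> (0 : R)) ->
  0 < r -> phi r < r.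
Proof.
move=> phi_le phi_cvg r0; rewrite ltNge; apply/negP => r_phi.
have := phi_cvg r r0; apply: (iter_vanishing_escape (P := fun s => r <= s) r0) => //.
move=> s rs; apply: (le_trans r_phi); apply: phi_le => //; exact: ltW.
Qed.

(** Without continuity from the right, phi may well map points close above r to
values above r that are close to r, but it cannot do so for all s > r. *)
Lemma comparison_gt_le phi r :
  (forall t, 0 < t -> (fun k => iter k phi t) @ \oo --> (0 : R)) ->
  0 < r -> exists2 s, r < s & phi s <= r.
Proof.
move=> phi_cvg r0; apply: contrapT => no_s.
have rS : r < r + 1 by rewrite ltrDl.
have := phi_cvg (r + 1) (lt_trans r0 rS).
apply: (iter_vanishing_escape (P := fun s => r < s) r0) => // [s /ltW//|s rs].
by rewrite ltNge; apply/negP => phi_s; apply: no_s; exists s.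
Qed.

(** This replaces the construction of one comparison function that majorises a
finite family.  If r = inf S were positive, a common s > r with phi_i s <= r for
all i would put r in S, and then max_i (phi_i r) < r would be in S as well. *)
Lemma comparison_family_inf n (phi : 'I_n -> R -> R) (S : set R) :
  (forall i s t, 0 <= s -> s <= t -> phi i s <= phi i t) ->
  (forall i t, 0 < t -> (fun k => iter k (phi i) t) @ \oo --> (0 : R)) ->
  S !=set0 ->
  (forall s t, S s -> s <= t -> S t) ->
  (forall s t, S s -> 0 <= s -> (forall i, phi i s <= t) -> S t) ->
  forall r, 0 < r -> S r.
Proof.
move=> phi_le phi_cvg S0 S_up S_phi; apply: contrapT => /existsNP[e /not_implyP[e0 Se]].
have S_lb : lbound S e.
  by move=> s Ss; rewrite leNgt; apply/negP => /ltW se; exact/Se/(S_up s).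
have r0 : 0 < inf S by rewrite (lt_le_trans e0)//; exact: lb_le_inf.
have S_gt s : inf S < s -> S s.
  by move=> /(inf_lt _)[|t St ts]; [exact: S0|exact: (S_up t _ St (ltW ts))].
have S_ge s : S s -> inf S <= s by move=> Ss; apply: ge_inf => //; exists e.
have [s rs phi_s] : exists2 s, inf S < s & forall i, phi i s <= inf S.
  have /choice[s_ s_P] : forall i, exists s, inf S < s /\ phi i s <= inf S.
    by move=> i; have [s ? ?] := comparison_gt_le (phi_cvg i) r0; exists s.
  (* The default value r + 1 serves the empty family. *)
  pose s := \big[Num.min/inf S + 1]_(i < n) s_ i.
  have rs : inf S < s.
    by apply/bigmin_gtP; split=> [|i _]; [rewrite ltrDl|exact: (s_P i).1].
  exists s => // i; apply: le_trans (s_P i).2.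
  by apply: phi_le; [exact/ltW/(lt_trans r0)|exact: bigmin_le_cond].
have Sr : S (inf S).
  by apply: (S_phi s) => //; [exact: S_gt|exact/ltW/(lt_trans r0)].
have /S_ge : S (\big[Num.max/0]_(i < n) phi i (inf S)).
  by apply: (S_phi _ _ Sr) => [|i]; [exact: ltW|exact: le_bigmax_cond].
apply/negP; rewrite -ltNge; apply/bigmax_ltP; split=> // i _.
exact: (comparison_lt (phi_le i) (phi_cvg i)).
Qed.

End comparison_functions.

(** * Domination along a relation *)

Section domination.
Set Implicit Arguments.
Unset Strict Implicit.
Context {R : realType} {T : tnorm R}.
Local Notation I := {i01 R}.
Local Notation C Y := (continuousType Y I).

Definition star_dominated (Y : topologicalType) (E : Y -> Y -> Prop)
    (mu nu : C Y -> I) : Prop :=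
  forall phi psi : C Y, (forall x y, E x y -> phi x <= psi y) -> mu phi <= nu psi.

Lemma star_dominated_sub (Y : topologicalType) (E F : Y -> Y -> Prop)
    (mu nu : C Y -> I) :
  (forall x y, E x y -> F x y) -> star_dominated E mu nu -> star_dominated F mu nu.
Proof. by move=> EF dE phi psi h; apply: dE => x y /EF; exact: h. Qed.

(** A constant fits between phi and psi, and both measures give it its own
value. *)
Lemma star_dominated_total (Y : topologicalType) (E : Y -> Y -> Prop)
    (mu nu : star_measure T Y) :
  (forall x y, E x y) -> star_dominated E mu nu.
Proof.
move=> EY phi psi h; pose c : I := i01_clip (sup (range (fun x => (phi x)%:num : R))).
have [Y0|/set0P[y0 _]] := eqVneq [set: Y] set0.
  have -> : phi = psi by apply/continuousEP => y; have : [set: Y] y by [];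
    rewrite Y0.
  have -> : psi = cst 1%:i01 by apply/continuousEP => y; have : [set: Y] y by []; rewrite Y0.
  by have [-> _ _] := star_measureP mu; have [-> _ _] := star_measureP nu.
have bphi : has_sup (range (fun x => (phi x)%:num : R)).
  split; first by exists (phi y0)%:num, y0.
  by exists 1 => _ [x _ <-]; exact: i01_le1.
have cE : c%:num = sup (range (fun x => (phi x)%:num : R)).
  apply: i01_clip_id.
    apply: (le_trans (i01_ge0 (phi y0))); apply: sup_upper_bound; first exact: bphi.
    by exists y0.
  by apply: ge_sup; [exists (phi y0)%:num, y0|move=> _ [x _ <-]; exact: i01_le1].
apply: (@le_trans _ _ c).
  have [muc _ _] := star_measureP mu; rewrite -[leRHS]muc; apply: star_measure_le => x.
  by rewrite i01_le [leRHS]cE; apply: sup_upper_bound; [exact: bphi|exists x].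
have [nuc _ _] := star_measureP nu; rewrite -[leLHS]nuc; apply: star_measure_le => y.
rewrite i01_le [leLHS]cE; apply: ge_sup; first by exists (phi y)%:num, y.
by move=> _ [x _ <-]; rewrite -i01_le; exact/h.
Qed.

Lemma star_dominated_map (Y Z : topologicalType) (E : Y -> Y -> Prop)
    (F : Z -> Z -> Prop) (f : continuousType Y Z) (mu nu : star_measure T Y) :
  (forall x y, E x y -> F (f x) (f y)) ->
  star_dominated E mu nu -> star_dominated F (star_map f mu) (star_map f nu).
Proof. by move=> fEF dE phi psi h; apply: dE => x y /fEF; exact: h. Qed.

(** Integrating over Z turns the comparison of phi and psi along the product
relation into a comparison of the partial integrals along E. *)
Lemma star_dominated_tensor (Y Z : topologicalType) (cZ : compact [set: Z])
    (E : Y -> Y -> Prop) (F : Z -> Z -> Prop)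
    (mu mu' : star_measure T Y) (nu nu' : star_measure T Z) :
  star_dominated E mu mu' -> star_dominated F nu nu' ->
  star_dominated (fun p q => E p.1 q.1 /\ F p.2 q.2)
    (star_tensor cZ mu nu) (star_tensor cZ mu' nu').
Proof.
move=> dE dF phi psi h; apply: dE => y y' yy'; apply: dF => z z' zz'.
by apply: h.
Qed.

Lemma star_dominated_sup (Y : topologicalType) (E : Y -> Y -> Prop) n
    (alpha : 'I_n -> I) (mu nu : 'I_n -> C Y -> I) :
  (forall i, star_dominated E (mu i) (nu i)) ->
  star_dominated E (star_sup T alpha mu) (star_sup T alpha nu).
Proof.
move=> dE phi psi h; apply: le_bigmax2 => i _.
by apply: tnorm_le => //; exact: dE.
Qed.

Lemma i01_le_cvg (K : Type) (F : set_system K) (FF : ProperFilter F)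
    (u v : K -> I) (a b : I) :
  u @ F --> a -> v @ F --> b -> (\forall k \near F, u k <= v k) -> a <= b.
Proof.
move=> ua vb uv; rewrite i01_le.
have h (w : K -> I) c : w @ F --> c -> (fun k => (w k)%:num : R) @ F --> (c%:num : R).
  by move=> wc; apply: continuous_cvg wc; exact: i01_val_continuous.
(* [ler_cvg_to] speaks of filters on topological spaces, whereas K is a mere
   type; F is therefore pushed forward to the plane. *)
pose w k : R * R := ((u k)%:num, (v k)%:num).
exact: (@ler_cvg_to _ (w @ F) _ R fst snd _ _ (h u a ua) (h v b vb) uv).
Qed.

(** * Ultralimits of star-measures *)

Lemma fmap_ultra (K L : Type) (f : K -> L) (F : set_system K) :
  UltraFilter F -> UltraFilter (f @ F).
Proof.
move=> FU; apply: Build_UltraFilter => G GP FG; apply/seteqP; split=> // B GB.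
have [//|nB] := in_ultra_setVsetC (f @^-1` B) FU.
have /FG GnB : (f @ F) (~` B) by [].
have G0 : G set0 by rewrite -(setICr B); exact: filterI.
by have /(_ GP G0) := @filter_not_empty _ G.
Qed.

(** Compactness of the space of star-measures in the form needed for existence:
the values at each phi converge because the unit interval is compact, and the
limits satisfy the axioms because the triangular norm and the maximum are
continuous. *)
Lemma star_measure_ultralimit (Y : topologicalType) (K : Type) (F : set_system K)
    (mu : K -> star_measure T Y) : UltraFilter F ->
  exists nu : star_measure T Y, forall phi, (fun k => mu k phi) @ F --> nu phi.
Proof.
move=> FU; have FP : ProperFilter F by exact: ultra_proper.
have /choice[nu nuP] : forall phi : C Y, exists c : I,
    (fun k => mu k phi) @ F --> c.
  move=> phi; have := @i01_compact R; rewrite compact_ultra.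
  by move=> /(_ _ (fmap_ultra (fun k => mu k phi) FU) filterT)[c [_ ?]]; exists c.
have uniq (phi : C Y) (c : I) : (fun k => mu k phi) @ F --> c -> nu phi = c.
  move=> muc; apply/eqP; rewrite eq_le; apply/andP; split.
    by apply: (i01_le_cvg FP (nuP phi) muc); apply: nearW => k.
  by apply: (i01_le_cvg FP muc (nuP phi)); apply: nearW => k.
suff nuM : is_star_measure T nu by exists (StarMeasure nuM).
split=> [c|l phi|phi psi]; apply: uniq.
- rewrite (_ : (fun k => _) = cst c); first exact: cvg_cst.
  by apply/funext => k; have [-> _ _] := star_measureP (mu k).
- rewrite (_ : (fun k => _) = (fun k => T l (mu k phi))).
    have hl : (fun=> l) @ F --> l by exact: cvg_cst.
    exact: (continuous2_cvg _ (@tnorm_continuous R T (l, nu phi)) hl (nuP phi)).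
  by apply/funext => k; have [_ -> _] := star_measureP (mu k).
- rewrite (_ : (fun k => _) = (fun k => Num.max (mu k phi) (mu k psi))).
    have cfst : continuous (@fst I I) by move=> p; exact: cvg_fst.
    have csnd : continuous (@snd I I) by move=> p; exact: cvg_snd.
    have cmx := @cmax_continuous R _ (mkcts cfst) (mkcts csnd) (nu phi, nu psi).
    exact: (continuous2_cvg _ cmx (nuP phi) (nuP psi)).
  by apply/funext => k; have [_ _ ->] := star_measureP (mu k).
Qed.


Lemma star_dominated_cvg (Y : topologicalType) (E : Y -> Y -> Prop)
    (K : Type) (F : set_system K) (FF : ProperFilter F)
    (mu nu : K -> star_measure T Y) (mu' nu' : star_measure T Y) :
  (forall phi, (fun k => mu k phi) @ F --> mu' phi) ->
  (forall phi, (fun k => nu k phi) @ F --> nu' phi) ->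
  (\forall k \near F, star_dominated E (mu k) (nu k)) ->
  star_dominated E mu' nu'.
Proof.
move=> mu_cvg nu_cvg dE phi psi h.
apply: (i01_le_cvg FF (mu_cvg phi) (nu_cvg psi)).
by apply: filterS dE => k; exact.
Qed.

End domination.

(** * Domination at a scale in a compact metric space *)

Section metric_domination.
Set Implicit Arguments.
Unset Strict Implicit.
Context {R : realType} {T : tnorm R} {X : metricType R} (cX : compact [set: X]).
Local Notation I := {i01 R}.
Local Notation C Y := (continuousType Y I).

Definition close (r : R) (x y : X) : Prop := mdist x y <= r.

Lemma compact_mdist_bounded : exists D : R, forall x y : X, mdist x y <= D.
Proof.
have [X0|/set0P[x0 _]] := eqVneq [set: X] set0.
  by exists 0 => x; have : [set: X] x by []; rewrite X0.
have : \forall M \near (+oo : set_system R), [set: X] `<=` (fun y => mdist x0 y <= M).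
  have /compact_near_coveringP := cX; apply=> y _.
  exists (ball y 1, [set M | mdist x0 y + 1 < M]) => /=.
    by split; [exact: nbhsx_ballx|apply: nbhs_pinfty_gt; rewrite num_real].
  move=> [z M] /=; rewrite ballEmdist /= => -[yz /ltW]; apply: le_trans.
  by apply: (le_trans (metric_triangle _ y _)); rewrite lerD2l ltW.
move=> /filter_ex[M MP]; exists (M + M) => x y.
apply: (le_trans (metric_triangle _ x0 _)).
by rewrite lerD ?MP// metric_sym MP.
Qed.

Lemma compact_unif_continuous (phi : C X) (e : R) : 0 < e ->
  exists2 r : R, 0 < r &
    forall x y, close r x y -> (phi x)%:num <= (phi y)%:num + e.
Proof.
move=> e0.
have : \forall r \near 0^'+, [set: X] `<=` (fun x =>
    forall y, close r x y -> (phi x)%:num <= (phi y)%:num + e).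
  have /compact_near_coveringP := cX; apply=> x _.
  have e20 : 0 < e / 2 by rewrite divr_gt0.
  have /cvg_ballP/(_ _ e20)/nbhs_ballP[r /= r0 xr] := @cts_fun _ _ phi x.
  have r20 : 0 < r / 2 by rewrite divr_gt0.
  exists (ball x (r / 2), [set s | s < r / 2]) => /=.
    by split; [exact: nbhsx_ballx|exact: nbhs_right_lt].
  move=> [y s] /=; rewrite ballEmdist /= => -[xy sr] z yz.
  have /xr : ball x r y by rewrite ballEmdist /=; lra.
  have /xr : ball x r z.
    rewrite ballEmdist /= (le_lt_trans (metric_triangle _ y _))//.
    by move: yz; rewrite /close; lra.
  by rewrite /= !i01_ballE !ltr_distl => /andP[? ?] /andP[? ?]; lra.
move=> h; near (0 : R)^'+ => r; exists r; first by near: r; exact: nbhs_right_gt.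
have H : [set: X] `<=` (fun x =>
    forall y, close r x y -> (phi x)%:num <= (phi y)%:num + e) by near: r.
by move=> x y; exact: H.
Unshelve. all: by end_near. Qed.

(** Uniform continuity of phi allows phi to be compared with phi + s at a small
scale, truncated at 1 to stay in the unit interval; the uniform continuity of nu
absorbs s. *)
Lemma star_dominated_le (mu nu : star_measure T X) (phi : C X) :
  (forall r, 0 < r -> star_dominated (close r) mu nu) -> mu phi <= nu phi.
Proof.
move=> d; rewrite i01_le; apply/ler_addgt0Pr => e e0.
have [s s0 nu_s] := star_measure_unif nu e0.
have [r r0 phi_r] := compact_unif_continuous phi s0.
have psi_cts : continuous (fun y => i01_clip ((phi y)%:num + s)).
  move=> y; apply: (continuous_comp (f := fun y => (phi y)%:num + s)).
    apply: (@cvgD _ R^o _ (nbhs y)); last exact: cvg_cst.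
    have /i01_continuousP := @cts_fun _ _ phi; exact.
  exact: i01_clip_continuous.
apply: (@le_trans _ _ (nu (mkcts psi_cts))%:num).
  rewrite -i01_le; apply: (d r) => // x y xy.
  by rewrite i01_le; apply: i01_clip_ge; [exact: phi_r|exact: i01_le1].
by apply: nu_s => y; apply: i01_clip_le; rewrite addr_ge0 ?i01_ge0// ltW.
Qed.

Lemma star_dominated_antisym (mu nu : star_measure T X) :
  (forall r, 0 < r -> star_dominated (close r) mu nu) ->
  (forall r, 0 < r -> star_dominated (close r) nu mu) -> mu = nu.
Proof.
move=> d d'; apply/star_measure_eqP => phi.
by apply/eqP; rewrite eq_le !star_dominated_le.
Qed.

Lemma star_dominated_tensor_pow (mu nu : star_measure T X) (r : R) m :
  star_dominated (close r) mu nu ->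
  star_dominated (fun x y : {ptws 'I_m.+1 -> X} => forall i, close r (x i) (y i))
    (star_tensor_pow cX mu m) (star_tensor_pow cX nu m).
Proof.
move=> d; elim: m => [|m IH] /=.
  by apply: star_dominated_map d => x y xy i.
apply: star_dominated_map (star_dominated_tensor cX IH d).
move=> [x x'] [y y'] /= [xy xy'] i.
change (close r (rcons_fun (x, x') i) (rcons_fun (y, y') i)); rewrite /rcons_fun.
by case: (unlift ord_max i) => [j|]; [exact: xy|exact: xy'].
Qed.

Lemma sym_dist_pi_le m (G : {group 'S_m}) (x y : {ptws 'I_m -> X}) (r : R) :
  0 <= r -> (forall i, close r (x i) (y i)) ->
  sym_dist (sym_pi X G x) (sym_pi X G y) <= r.
Proof.
move=> r0 xy; rewrite sym_distE; apply: (le_trans (bigmin_le_id _ _ _ _)).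
by apply/perm_dist_leP; split=> // i; rewrite perm1; exact: xy.
Qed.

(** * The operator of the function system and its fixed points *)

Section operator.
Context {m n : nat} {G : {group 'S_m.+1}} {g : 'I_n -> sym_power X G -> X}
  {alpha : 'I_n -> I} (gP : forall i, matkowski_contraction (g i))
  (alphaP : is_star_measure T (finite_star_fun T alpha)).

Definition gifs_step (mu : star_measure T X) : star_measure T X :=
  gifs_operator alphaP (fun i => mkcts (matkowski_continuous (gP i)))
    (sym_tensor_pow cX G mu).

(** Points of X^m that are coordinatewise r-close have r-close orbits, and g_i
brings r-close orbits within phi_i r of each other. *)
Lemma star_dominated_gifs_step (phi : 'I_n -> R -> R) (r t : R)
    (mu nu : star_measure T X) :
  (forall i s t, 0 <= s -> s <= t -> phi i s <= phi i t) ->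
  (forall i a b, mdist (g i a) (g i b) <= phi i (sym_dist a b)) ->
  0 <= r -> (forall i, phi i r <= t) ->
  star_dominated (close r) mu nu ->
  star_dominated (close t) (gifs_step mu) (gifs_step nu).
Proof.
move=> phi_le g_phi r0 phi_t d; apply: star_dominated_sup => i.
apply: (star_dominated_map (E := fun a b => sym_dist a b <= r)).
  move=> a b ab; apply: (le_trans (g_phi i a b)); apply: le_trans (phi_t i).
  by apply: phi_le => //; exact: sym_dist_ge0.
apply: (star_dominated_map (f := sym_pi X G) _ (star_dominated_tensor_pow d)).
by move=> x y; exact: sym_dist_pi_le.
Qed.

Lemma gifs_step_nonexpansive (r : R) (mu nu : star_measure T X) : 0 < r ->
  star_dominated (close r) mu nu ->
  star_dominated (close r) (gifs_step mu) (gifs_step nu).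
Proof.
move=> r0; have /choice[phi phiP] := gP.
apply: (star_dominated_gifs_step (phi := phi)).
- by move=> i; have [_ + _ _] := phiP i.
- by move=> i; have [_ _ _ +] := phiP i.
- exact: ltW.
- by move=> i; have [_ phi_le phi_cvg _] := phiP i; exact/ltW/comparison_lt.
Qed.

(** The quantifier over mu and nu comes after the one over k: the same N serves
a measure and its own iterates, which makes the
iterates a Cauchy sequence. *)
Lemma gifs_step_iter_asymptotic (r : R) : 0 < r ->
  exists N, forall k, (N <= k)%N -> forall mu nu,
    star_dominated (close r) (iter k gifs_step mu) (iter k gifs_step nu).
Proof.
have /choice[phi phiP] := gP.
apply: (comparison_family_inf (phi := phi) (S := fun r => exists N, forall k,
  (N <= k)%N -> forall mu nu,
    star_dominated (close r) (iter k gifs_step mu) (iter k gifs_step nu))).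
- by move=> i; have [_ + _ _] := phiP i.
- by move=> i; have [_ _ + _] := phiP i.
- have [D XD] := compact_mdist_bounded.
  by exists D, 0%N => k _ mu nu; apply: star_dominated_total => x y; exact: XD.
- move=> s t [N Ns] st; exists N => k Nk mu nu.
  by apply: star_dominated_sub (Ns k Nk mu nu) => x y xy; exact: le_trans st.
- move=> s t [N Ns] s0 phi_t; exists N.+1 => -[//|k] Nk mu nu /=.
  apply: (star_dominated_gifs_step (phi := phi) (r := s)) => //.
  + by move=> i; have [_ + _ _] := phiP i.
  + by move=> i; have [_ _ _ +] := phiP i.
  + exact: Ns.
Qed.

Lemma gifs_invariant_unique (mu nu : star_measure T X) :
  mu = gifs_step mu -> nu = gifs_step nu -> mu = nu.
Proof.
have fixK la k : la = gifs_step la -> iter k gifs_step la = la.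
  by move=> laE; elim: k => //= k ->.
move=> muE nuE; apply: star_dominated_antisym => r r0.
- have [N /(_ N (leqnn N) mu nu)] := gifs_step_iter_asymptotic r0.
  by rewrite !fixK.
- have [N /(_ N (leqnn N) nu mu)] := gifs_step_iter_asymptotic r0.
  by rewrite !fixK.
Qed.

Lemma gifs_invariant_exists : [set: X] !=set0 ->
  exists mu : star_measure T X, mu = gifs_step mu.
Proof.
move=> [x0 _].
have delta_measure : is_star_measure T (@dirac_fun R X x0) by [].
pose mu_ k := iter k gifs_step (StarMeasure delta_measure).
have [F [FU oo_F]] := ultraFilterLemma (@eventually_filter).
have FP : ProperFilter F by exact: ultra_proper.
have F_ge N : \forall k \near F, (N <= k)%N by apply: oo_F; exists N.
have [mu mu_cvg] := star_measure_ultralimit mu_ FU.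
have cst_cvg (nu : star_measure T X) (phi : C X) : (fun=> nu phi) @ F --> nu phi.
  exact: cvg_cst.
have mu_near r : 0 < r -> exists N, forall k, (N <= k)%N ->
    star_dominated (close r) (mu_ k) mu /\ star_dominated (close r) mu (mu_ k).
  move=> r0; have [N NP] := gifs_step_iter_asymptotic r0.
  (* For l >= k, mu_ l is the k-th iterate of the measure mu_ (l - k). *)
  exists N => k Nk; split.
  - apply: (star_dominated_cvg FP (cst_cvg (mu_ k)) mu_cvg).
    apply: filterS (F_ge k) => l kl; rewrite /mu_ -(subnKC kl) iterD; exact: NP.
  - apply: (star_dominated_cvg FP mu_cvg (cst_cvg (mu_ k))).
    apply: filterS (F_ge k) => l kl; rewrite /mu_ -(subnKC kl) iterD; exact: NP.
exists mu; apply: star_dominated_antisym => r r0; have [N NP] := mu_near r r0.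
- apply: (star_dominated_cvg FP mu_cvg (cst_cvg (gifs_step mu))).
  apply: filterS (F_ge N.+1) => -[//|k] Nk.
  exact/(gifs_step_nonexpansive r0)/(NP k Nk).1.
- apply: (star_dominated_cvg FP (cst_cvg (gifs_step mu)) mu_cvg).
  apply: filterS (F_ge N.+1) => -[//|k] Nk.
  exact/(gifs_step_nonexpansive r0)/(NP k Nk).2.
Qed.

End operator.
End metric_domination.

Theorem theorem3p1 (R : realType) (X : metricType R) (m n : nat)
    (G : {group 'S_m.+1}) (T : tnorm R)
    (g : 'I_n -> sym_power X G -> X) (alpha : 'I_n -> {i01 R})
    (X_nonempty : [set: X] !=set0) (cX : compact [set: X])
    (gP : forall i : 'I_n, matkowski_contraction (g i))
    (alphaP : is_star_measure T (finite_star_fun T alpha)) :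
  exists! mu : star_measure T X, gifs_invariant cX gP alphaP mu.
Proof.
have [mu muE] := gifs_invariant_exists cX gP alphaP X_nonempty.
exists mu; split=> // nu; exact: gifs_invariant_unique.
Qed.
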